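(* Let $\mathcal{M}\in\{\mathrm{rank},\mathsf{PDT}\}$. (1) If there are constants $c_1,k_1>0$ such that for every $n\ge2$ and every Boolean function $f:\{0,1\}^n\to\{0,1\}$, $\mathcal{M}(f)\le c_1\deg(f)^2(\log n)^{k_1}$, then there are constants $c_2,k_2>0$ such that for every $n\ge2$ and every $f:\{0,1\}^n\to\{0,1\}$, $\mathrm{D}(f)\le c_2\deg(f)^2(\log n)^{k_2}$. (2) If there are constants $c_1,k_1>0$ such that for every $n\ge2$ and every $f:\{0,1\}^n\to\{0,1\}$, $\mathcal{M}(f)\le c_1\mathrm{bs}(f)^2(\log n)^{k_1}$, then there are constants $c_2,k_2>0$ such that for every $n\ge2$ and every $f:\{0,1\}^n\to\{0,1\}$, $\mathrm{D}(f)\le c_2\mathrm{fbs}(f)^2(\log n)^{k_2}$.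
   Context: Logarithms are base 2. $\mathrm{D}(f)$ is the minimum depth of a deterministic decision tree (each internal node queries a single input bit, branching on its value; leaves labelled $0/1$) computing $f$. Rank of a decision tree: a leaf has rank $0$; an internal node with children of ranks $r_1,r_2$ has rank $\max(r_1,r_2)$ if $r_1\ne r_2$ and $r_1+1$ if $r_1=r_2$; the tree's rank is the rank of its root; $\mathrm{rank}(f)$ is the minimum rank of a decision tree computing $f$. A parity decision tree is like a decision tree but each internal node is labelled by a set $S\subseteq[n]$ and branches on $\bigoplus_{i\in S}x_i$; $\mathsf{PDT}(f)$ is the minimum depth of a parity decision tree computing $f$. $\deg(f)$ is the degree of the unique multilinear real polynomial agreeing with $f$ on $\{0,1\}^n$. For $B\subseteq[n]$, $x^{\oplus B}$ is $x$ with bits in $B$ flipped; $B$ is a sensitive block of $x$ if $f(x^{\oplus B})\ne f(x)$; $\mathrm{bs}(f)=\max_x$ (maximum number of pairwise disjoint sensitive blocks of $x$). $\mathrm{fbs}(f,x)$ is the maximum of $\sum_B w_B$ over weights $w_B\in[0,1]$ on the sensitive blocks $B$ of $x$ subject to $\sum_{B\ni i}w_B\le1$ for every $i$; $\mathrm{fbs}(f)=\max_x\mathrm{fbs}(f,x)$. *)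

(* Defs.v *)
From HB Require Import structures.
From mathcomp Require Import all_boot all_order all_algebra.
(* The notations of mpoly clash with those of MathComp-Analysis. *)
From mathcomp Require Import -(notations) mpoly.
From mathcomp Require Import boolp classical_sets reals exp.

Set Implicit Arguments.
Unset Strict Implicit.
Unset Printing Implicit Defensive.

Import Order.TTheory GRing.Theory Num.Theory.

Notation cube n := {ffun 'I_n -> bool}.
Notation boolfun n := (cube n -> bool).

(* Trees whose internal nodes carry a query in Q; [Node q t0 t1] continues in
   t0 or t1 when the answer to q is false or true respectively. *)
Inductive tree (Q : Type) : Type :=
| Leaf of bool
| Node of Q & tree Q & tree Q.

Arguments Leaf {Q} _.

Section Trees.
Variable Q : Type.

Fixpoint tree_eval (ans : Q -> bool) (t : tree Q) : bool :=
  match t with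
  | Leaf b => b
  | Node q t0 t1 => if ans q then tree_eval ans t1 else tree_eval ans t0
  end.

Fixpoint tree_depth (t : tree Q) : nat :=
  match t with
  | Leaf _ => 0
  | Node _ t0 t1 => (maxn (tree_depth t0) (tree_depth t1)).+1
  end.

Fixpoint tree_rank (t : tree Q) : nat :=
  match t with
  | Leaf _ => 0
  | Node _ t0 t1 =>
      let r0 := tree_rank t0 in let r1 := tree_rank t1 in
      if r0 == r1 then r0.+1 else maxn r0 r1
  end.

Definition computes n (ans : cube n -> Q -> bool) (t : tree Q)
    (f : boolfun n) : Prop :=
  forall x, tree_eval (ans x) t = f x.

Lemma cost_exists n (ans : cube n -> Q -> bool) (cost : tree Q -> nat)
    (f : boolfun n) :
  (exists t, computes ans t f) ->
  exists c, `[< exists2 t, computes ans t f & cost t = c >].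
Proof. by move=> [t tf]; exists (cost t); apply/asboolP; exists t. Qed.

Definition min_cost n (ans : cube n -> Q -> bool) (cost : tree Q -> nat)
    (f : boolfun n) (ex : exists t, computes ans t f) : nat :=
  ex_minn (cost_exists cost ex).

End Trees.

Definition bit_query n (x : cube n) (i : 'I_n) : bool := x i.

Definition parity_query n (x : cube n) (S : {set 'I_n}) : bool :=
  \big[addb/false]_(i in S) x i.

Lemma dtree_exists n (f : boolfun n) : exists t, computes (@bit_query n) t f.
Proof.
suff H (s : seq 'I_n) (z : cube n) : exists t : tree 'I_n,
    forall x : cube n, (forall i, i \notin s -> x i = z i) ->
      tree_eval (bit_query x) t = f x.
  have [t ht] := H (enum 'I_n) [ffun=> false].
  by exists t => x; apply: ht => i; rewrite mem_enum.
elim: s z => [|a s IH] z.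
  by exists (Leaf (f z)) => x xz; congr f; apply/ffunP => i; rewrite xz.
pose z' b : cube n := [ffun i => if i == a then b else z i].
have [t0 h0] := IH (z' false); have [t1 h1] := IH (z' true).
exists (Node a t0 t1) => x xz /=; rewrite /bit_query.
case xa: (x a); [apply: h1 | apply: h0] => i i_s; rewrite ffunE;
  case: eqP => [->//|/eqP ia]; by apply: xz; rewrite inE negb_or ia.
Qed.

Lemma pdtree_exists n (f : boolfun n) :
  exists t, computes (@parity_query n) t f.
Proof.
have [t tf] := dtree_exists f.
pose fix conv (t : tree 'I_n) : tree {set 'I_n} :=
  match t with
  | Leaf b => Leaf b
  | Node i t0 t1 => Node [set i] (conv t0) (conv t1)
  end.
exists (conv t) => x; rewrite -tf; elim: t {tf} => //= i t0 -> t1 ->.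
by rewrite /parity_query big_set1.
Qed.

Definition D n (f : boolfun n) : nat :=
  min_cost (@tree_depth 'I_n) (dtree_exists f).

Definition rank n (f : boolfun n) : nat :=
  min_cost (@tree_rank 'I_n) (dtree_exists f).

Definition PDT n (f : boolfun n) : nat :=
  min_cost (@tree_depth {set 'I_n}) (pdtree_exists f).

Definition flip n (x : cube n) (B : {set 'I_n}) : cube n :=
  [ffun i => x i (+) (i \in B)].

Definition sensitive n (f : boolfun n) (x : cube n) (B : {set 'I_n}) : bool :=
  f (flip x B) != f x.

Definition bs_at n (f : boolfun n) (x : cube n) : nat :=
  \max_(P : {set {set 'I_n}} | finset.trivIset P && [forall B in P, sensitive f x B])
     #|P|.

Definition bs n (f : boolfun n) : nat := \max_(x : cube n) bs_at f x.

Local Open Scope ring_scope.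

Section Real.
Variable R : realType.

Definition fractional_packing n (f : boolfun n) (x : cube n)
    (w : {set 'I_n} -> R) : Prop :=
  (forall B, sensitive f x B -> 0 <= w B <= 1) /\
  (forall i : 'I_n, \sum_(B | sensitive f x B && (i \in B)) w B <= 1).

(* A maximum: the weights on the sensitive blocks range over a nonempty compact
   polytope. It is nonnegative (take w = 0), so 0 is harmless in fbs. *)
Definition fbs_at n (f : boolfun n) (x : cube n) : R :=
  sup [set \sum_(B | sensitive f x B) w B | w in fractional_packing f x].

Definition fbs n (f : boolfun n) : R := \big[Num.max/0]_(x : cube n) fbs_at f x.

Lemma fbs_at_has_sup n (f : boolfun n) (x : cube n) :
  has_sup [set \sum_(B | sensitive f x B) w B | w in fractional_packing f x].
Proof.
split.
  exists 0, (fun=> 0); last by rewrite big1.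
  split=> [B _|i]; first by rewrite lexx ler01.
  by rewrite big1.
exists (\sum_(B | sensitive f x B) 1) => _ [w [w01 _] <-].
by apply: ler_sum => B /w01 /andP[].
Qed.

Definition multilinear n (p : mpoly n R) : Prop :=
  forall m : multinom n, m \in msupp p -> forall i : 'I_n, (m i <= 1)%N.

Definition agrees n (p : mpoly n R) (f : boolfun n) : Prop :=
  forall x : cube n, meval (fun i => (x i)%:R) p = (f x)%:R.

Lemma multilinearP n (p : mpoly n R) :
  multilinear p <->
  (forall m : multinom n, ~~ [forall i : 'I_n, (m i <= 1)%N] -> mcoeff m p = 0).
Proof.
split=> [pM m|pM m mp].
  by apply: contraNeq; rewrite -mcoeff_msupp => /pM mi; apply/forallP.
by apply/forallP; apply: contraLR mp => /pM; rewrite -mcoeff_eq0 => ->; rewrite eqxx.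
Qed.

Lemma multilinear_exists n (f : boolfun n) :
  exists p : mpoly n R, multilinear p /\ agrees p f.
Proof.
pose a (b : bool) : R := if b then 1 else -1.
pose c (b : bool) : R := (~~ b)%:R.
pose e (x : cube n) : mpoly n R :=
  \sum_(J : {set 'I_n})
     (\prod_i (if i \in J then a (x i) else c (x i))) *: mpolyX R (mesym1 J).
have eM x : multilinear (e x).
  apply/multilinearP => m mM; rewrite raddf_sum big1 //= => J _.
  rewrite mcoeffZ mcoeffX; case: eqP => [mE|_]; last by rewrite mulr0.
  case/negP: mM; apply/forallP => i; rewrite -mE mnmE.
  by case: (i \in J).
have eE (x y : cube n) : meval (fun i => (y i)%:R) (e x) = (x == y)%:R.
  transitivity (\prod_i (a (x i) * (y i)%:R + c (x i))).
    rewrite bigA_distr /e raddf_sum /=; apply: eq_bigr => J _.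
    rewrite mevalZ mevalX -big_split /=; apply: eq_bigr => i _.
    by rewrite mnmE; case: (i \in J); rewrite ?expr1 ?expr0 ?mulr1.
  have [->|xy] := eqVneq x y.
    rewrite big1 // => i _; rewrite /a /c.
    by case: (y i); rewrite /= ?mulr1 ?mulr0 ?addr0 ?add0r.
  have [i xyi] : exists i, x i != y i.
    apply/existsP; apply: contraR xy; rewrite negb_exists => /forallP h.
    by apply/eqP/ffunP => i; apply/eqP; rewrite -[_ == _]negbK.
  apply/eqP; rewrite (bigD1 i) //= mulf_eq0; apply/orP; left; apply/eqP.
  move: xyi; rewrite /a /c.
  by case: (x i); case: (y i) => //= _; rewrite ?mulr0 ?mulr1 ?addr0 ?addNr.
exists (\sum_(x | f x) e x); split.
  apply/multilinearP => m mM; rewrite raddf_sum big1 //= => x _.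
  by have /multilinearP -> := eM x.
move=> y; rewrite raddf_sum /=; under eq_bigr do rewrite eE.
have [fy|fy] := boolP (f y); last first.
  rewrite big1 // => x fx; case: eqVneq => // xy.
  by move: fy; rewrite -xy fx.
rewrite (bigD1 y) //= eqxx big1 ?addr0 // => x /andP[_ /negPf ->].
by [].
Qed.

Lemma multilinear_unique n (f : boolfun n) (p q : mpoly n R) :
  multilinear p -> agrees p f -> multilinear q -> agrees q f -> p = q.
Proof.
move=> /multilinearP pM pf /multilinearP qM qf; apply/eqP; rewrite -subr_eq0.
set r := p - q.
have rM : multilinear r.
  by apply/multilinearP => m mM; rewrite mcoeffB pM ?qM ?subr0.
have r0 x : meval (fun i => ((x : cube n) i)%:R) r = 0.
  by rewrite mevalB pf qf subrr.
apply: contraT => rN0; have mr := mlast_supp rN0.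
set m := mlast r in mr; pose x : cube n := [ffun i => m i != 0%N].
move: (r0 x); rewrite mevalE (bigD1_seq m) ?msupp_uniq //=.
rewrite [X in _ * X]big1 => [|i _]; last first.
  by rewrite ffunE; case: (m i) => [|k]; rewrite ?expr0 ?expr1n.
rewrite mulr1 big_seq_cond big1 => [/eqP|m' /andP[m'r m'm]]; last first.
  have [i /andP[mi m'i]] : exists i, (m i == 0%N) && (m' i != 0%N).
    apply/existsP; apply: contraR m'm; rewrite negb_exists => /forallP h.
    apply/eqP/le_anti; rewrite mlast_lemc // andbT; apply: lem_leo.
    apply/mnm_lepP => i; have := h i; rewrite negb_and negbK.
    have := rM _ m'r i; case: (m' i) => [|[|//]] // _.
    by case: (m i).
  by rewrite (bigD1 i) //= ffunE mi /= expr0n (negPf m'i) mul0r mulr0.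
by rewrite addr0 (mcoeff_eq0 r) mr.
Qed.

Definition multilinear_repr n (f : boolfun n) : mpoly n R :=
  projT1 (cid (multilinear_exists f)).

(* mmeasure mdeg p is 1 + the total degree of p, and 0 for p = 0; the zero
   function thus gets degree 0. *)
Definition deg n (f : boolfun n) : nat :=
  (mmeasure mdeg (multilinear_repr f)).-1.

Definition log2 (n : nat) : R := ln n%:R / ln 2.

End Real.

(* Main.v *)
(** Compose f with the majority of three bits in each coordinate and call the
    result F, a function of 3n bits. Any two of the three bits can fix the
    majority whatever the third one is. So in a parity decision tree for F a
    query that is not yet determined can be answered either way by one bit of a
    fresh block, while the other two bits of that block still force its majority
    to any prescribed value. Moving to the child of smaller rank at the cost of
    one query to f shows that D(f) is at most the rank, as a tree, of any parity
    decision tree for F, hence at most rank(F) and PDT(F). On the other hand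
    deg(F) <= 3 deg(f) and bs(F) <= 3 fbs(f): disjoint sensitive blocks of F,
    projected to the coordinates of f whose majority changes and given weight
    1/3 each, form a fractional packing. *)
Require Import Defs.
From mathcomp Require Import all_boot all_order all_algebra.
From mathcomp Require Import -(notations) mpoly.
From mathcomp Require Import ring.
From mathcomp Require Import boolp classical_sets reals exp.
Import Order.TTheory GRing.Theory Num.Theory.
Local Open Scope ring_scope.

Set Implicit Arguments.
Unset Strict Implicit.
Unset Printing Implicit Defensive.

(** * Majority of three bits, applied blockwise *)

Definition maj (w : option bool -> bool) : bool :=
  if w (Some false) == w (Some true) then w (Some false) else w None.

Lemma maj_stifled (w : option bool -> bool) (j : option bool) (b : bool) :
  (forall j', j' != j -> w j' = b) -> maj w = b.
Proof.
rewrite /maj; case: j => [[]|] wE.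
- by rewrite (wE (Some false)) // (wE None) //; case: eqP.
- by rewrite (wE (Some true)) // (wE None) //; case: eqP => // ->.
- by rewrite (wE (Some true)) // (wE (Some false)) // eqxx.
Qed.

(** Taken as a cardinality so that [enum_rank] and [enum_val] translate between bits and pairs
    (block, index). *)
Definition width n : nat := #|{: 'I_n * option bool}|.

Lemma widthE n : width n = (n * 3)%N.
Proof. by rewrite /width card_prod card_option card_bool card_ord. Qed.

Definition pos n (i : 'I_n) (j : option bool) : 'I_(width n) := enum_rank (i, j).

Definition block n (p : 'I_(width n)) : 'I_n := (enum_val p).1.

Lemma block_pos n (i : 'I_n) j : block (pos i j) = i.
Proof. by rewrite /block enum_rankK. Qed.

Lemma pos_surj n (p : 'I_(width n)) : exists j, p = pos (block p) j.
Proof.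
by exists (enum_val p).2; rewrite /pos /block -surjective_pairing enum_valK.
Qed.

Lemma pos_inj n (i : 'I_n) : injective (pos i).
Proof. by move=> j j' /enum_rank_inj []. Qed.

Definition majs n (x : cube (width n)) : cube n :=
  [ffun i => maj (fun j => x (pos i j))].

Lemma majs_onto n (z : cube n) : majs [ffun p => z (block p)] = z.
Proof.
apply/ffunP => i; rewrite ffunE; apply: (@maj_stifled _ None) => j _.
by rewrite ffunE block_pos.
Qed.

(** * Affine functions over the field with two elements *)

Section Affine.
Variable n : nat.
Implicit Types (x y w : cube n) (h : cube n -> bool).

(** A sum of three points is an affine combination over the field with two elements. An odd number
    of summands lets maps with constant terms, such as [force], preserve it. *)
Definition xor3 x y w : cube n := [ffun p => x p (+) y p (+) w p].

Definition affine h := forall x y w, h (xor3 x y w) = h x (+) h y (+) h w.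

Lemma affine_parity S : affine (fun x => parity_query x S).
Proof.
move=> x y w; rewrite /parity_query -!big_split /=.
by apply: eq_bigr => p _; rewrite ffunE.
Qed.

Lemma flipU1 x (p : 'I_n) (B : {set 'I_n}) :
  p \notin B -> flip x (p |: B) = flip (flip x B) [set p].
Proof.
move=> pB; apply/ffunP => q; rewrite !ffunE !inE -addbA; congr (_ (+) _).
by case: eqP => [->|_]; rewrite ?(negPf pB) ?addbF.
Qed.

(** The point [flip y [set p]] is the sum of [y], [x] and [flip x [set p]]. Hence whether bit [p]
    matters to [h] does not depend on the point. *)
Lemma affine_flip h (p : 'I_n) x y : affine h ->
  h (flip y [set p]) = h y (+) (h x (+) h (flip x [set p])).
Proof.
move=> hA; rewrite addbA -hA; congr h; apply/ffunP => q; rewrite !ffunE.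
by rewrite -addbA addKb.
Qed.

(** By [affine_flip] each bit changes [h] either everywhere or nowhere. If every bit did so nowhere,
    flipping one bit at a time would lead from [x] to [y] without changing [h]. *)
Lemma affine_sensitive_bit h x y : affine h -> h x != h y ->
  exists p, forall w, h (flip w [set p]) = ~~ h w.
Proof.
move=> hA hxy; have [/existsP [p /forallP hp]|none] :=
  boolP [exists p, forall w, h (flip w [set p]) == ~~ h w].
  by exists p => w; apply/eqP.
suff flipE B : h (flip x B) = h x.
  case/eqP: hxy; rewrite -(flipE [set p | x p (+) y p]); congr h.
  by apply/ffunP => p; rewrite ffunE inE addKb.
have flip1 p w : h (flip w [set p]) = h w.
  move: none; rewrite negb_exists => /forallP /(_ p).
  rewrite negb_forall => /existsP [v].
  rewrite (affine_flip p v w hA); case: (h v); case: (h _) => //=;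
  by rewrite ?addbF.
elim: {B}#|B| {-2}B (erefl #|B|) => [B /eqP|k IH B kB].
  rewrite cards_eq0 => /eqP ->; congr h; apply/ffunP => p.
  by rewrite ffunE inE addbF.
have /card_gt0P [p pB] : (0 < #|B|)%N by rewrite kB.
rewrite -(finset.setD1K pB) flipU1 ?finset.setD11 // flip1; apply: IH.
by move: kB; rewrite (cardsD1 p) pB => -[].
Qed.

End Affine.

(** * Forcing a query answer and a block majority together *)

(* The affine map that gives every bit other than [p] of the block of [p] the
   value [b], and then sets bit [p] so that [h] takes the value [c]. *)
Definition force n (h : cube (width n) -> bool) (p : 'I_(width n)) (b c : bool)
    (x : cube (width n)) : cube (width n) :=
  let y : cube (width n) :=
    [ffun q => if block q == block p then (q != p) && b else x q] in
  if h y == c then y else flip y [set p].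

Section Force.
Variables (n : nat) (h : cube (width n) -> bool) (p : 'I_(width n)).
Variables (b c : bool).
Hypothesis hp : forall x, h (flip x [set p]) = ~~ h x.

Lemma force_query x : h (force h p b c x) = c.
Proof.
rewrite /force; case: ifP => [/eqP //|]; rewrite hp.
by case: (h _); case: c.
Qed.

(** Forcing overwrites the whole block of [p], and the decision to flip [p] depends on [h] alone.
    This adds that block to the set of blocks whose bits are ignored. *)
Lemma force_eq (U : {set 'I_n}) (x y : cube (width n)) :
  (forall v w : cube (width n),
     (forall q, block q \notin U -> v q = w q) -> h v = h w) ->
  (forall q, block q \notin block p |: U -> x q = y q) ->
  forall q, block q \notin U -> force h p b c x q = force h p b c y q.
Proof.
move=> hU xy q qU; rewrite /force; set x' := finfun _; set y' := finfun _.
have xy' r : block r \notin U -> x' r = y' r.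
  move=> rU; rewrite !ffunE; case: eqP => // /eqP rp.
  by apply: xy; rewrite !inE negb_or rp.
by rewrite (hU x' y') //; case: ifP => _; rewrite ?[flip _ _ _]ffunE xy' // ffunE.
Qed.

Lemma force_block x : majs (force h p b c x) (block p) = b.
Proof.
have [j pE] := pos_surj p.
rewrite ffunE; apply: (@maj_stifled _ j) => j' j'j.
have j'p : pos (block p) j' != p by rewrite {2}pE (inj_eq (@pos_inj _ _)).
by rewrite /force; case: ifP => _;
  rewrite !ffunE ?inE block_pos eqxx j'p // (negPf j'p) addbF.
Qed.

Lemma force_other x i : i != block p -> majs (force h p b c x) i = majs x i.
Proof.
move=> ip; rewrite !ffunE; congr maj; apply/funext => j.
have jp : pos i j != p by apply: contraNneq ip => <-; rewrite block_pos.
by rewrite /force; case: ifP => _;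
  rewrite !ffunE ?inE block_pos (negPf ip) // (negPf jp) addbF.
Qed.

Lemma force_affine : affine h -> forall x y w,
  force h p b c (xor3 x y w) =
  xor3 (force h p b c x) (force h p b c y) (force h p b c w).
Proof.
move=> hA x y w.
pose base (v : cube (width n)) : cube (width n) :=
  [ffun q => if block q == block p then (q != p) && b else v q].
have baseA : base (xor3 x y w) = xor3 (base x) (base y) (base w).
  apply/ffunP => q; rewrite !ffunE; case: eqP => // _.
  by case: (_ && _).
(* The conditional flip is written as adding a correction to bit [p] that is affine in [v]. *)
have forceE v : force h p b c v = [ffun q => base v q (+)
    ((q == p) && (h (base v) (+) c))].
  rewrite /force -/(base v); apply/ffunP => q; rewrite [RHS]ffunE.
  case: (h _); case: c => /=; rewrite ?andbF ?addbF // ?andbT ffunE inE //.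
apply/ffunP => q; rewrite !forceE baseA hA.
move: (base x) (base y) (base w) => x1 y1 w1; rewrite !ffunE.
case: (q == p); rewrite /= ?addbF //.
by case: (x1 q); case: (y1 q); case: (w1 q); case: c; case: (h x1);
  case: (h y1); case: (h w1).
Qed.

End Force.

(** * Simulating a parity decision tree by queries to [f] *)

(* [phi] substitutes for the bits of the blocks in [U] affine functions of the
   other bits, so that block [i] in [U] has majority [z0 i]. *)
Definition restriction n (U : {set 'I_n}) (z0 : cube n)
    (phi : cube (width n) -> cube (width n)) : Prop :=
  [/\ forall x y w, phi (xor3 x y w) = xor3 (phi x) (phi y) (phi w),
      forall x y : cube (width n),
        (forall q, block q \notin U -> x q = y q) -> phi x = phi y &
      forall x i, majs (phi x) i = if i \in U then z0 i else majs x i].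

(** Induction on [t], stated for restricted inputs so that it survives descending: [U] holds the
    coordinates of [f] queried so far and [z0] their answers. *)
Lemma restriction_simulation n (f : boolfun n) (t : tree {set 'I_(width n)})
    (U : {set 'I_n}) (z0 : cube n) (phi : cube (width n) -> cube (width n)) :
  restriction U z0 phi ->
  (forall x, tree_eval (parity_query (phi x)) t = f (majs (phi x))) ->
  exists2 T : tree 'I_n, (tree_depth T <= tree_rank t)%N &
    forall z : cube n, (forall i, i \in U -> z i = z0 i) ->
      tree_eval (bit_query z) T = f z.
Proof.
elim: t U z0 phi => [b|S t0 IH0 t1 IH1] U z0 phi phiR phit; have [phiA phiU phiz] := phiR.
  exists (Leaf b) => // z zU.
  (* The test input repeats each bit of [z] three times, so its majorities are [z]. *)
  apply: etrans (phit [ffun p => z (block p)]) _; congr f; apply/ffunP => i.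
  by rewrite phiz majs_onto; case: ifP => // /zU.
pose h x := parity_query (phi x) S.
pose child c := if c then t1 else t0.
have IH c U' z1 psi : restriction U' z1 psi ->
    (forall x, tree_eval (parity_query (psi x)) (child c) = f (majs (psi x))) ->
    exists2 T : tree 'I_n, (tree_depth T <= tree_rank (child c))%N &
      forall z : cube n, (forall i, i \in U' -> z i = z1 i) ->
        tree_eval (bit_query z) T = f z.
  by case: c; [apply: IH1 | apply: IH0].
have rank_child c : (tree_rank (child c) <= tree_rank (Node S t0 t1))%N.
  rewrite /= /child; case: eqP => [e|_]; case: c.
  - by rewrite -e leqnSn.
  - by rewrite leqnSn.
  - exact: leq_maxr.
  - exact: leq_maxl.
(* A query that is constant under [phi] is answered without querying [f]. *)
have [/forallP h0|] := boolP [forall x, h x == h [ffun=> false]].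
  have hE x : h x = h [ffun=> false] by apply/eqP.
  have [|T Tr Tf] := IH (h [ffun=> false]) U z0 phi phiR.
    by move=> x; rewrite -phit /= -/(h x) (hE x) /child; case: (h _).
  by exists T => //; apply: leq_trans Tr (rank_child _).
rewrite negb_forall => /existsP [x hx].
have hA : affine h by move=> y v w; rewrite /h phiA affine_parity.
have [p hp] := affine_sensitive_bit hA hx.
(* The block of [p] is fresh, because [phi] ignores the bits of blocks in [U]. *)
have pU : block p \notin U.
  apply/negP => pU; have := hp x; rewrite /h (phiU _ x) => [|q qU].
    by case: (parity_query _ _).
  rewrite !ffunE !inE; case: eqP => [qp|_]; last by rewrite addbF.
  by rewrite qp pU in qU.
(* Both answers are possible, so follow the child of smaller rank. *)
pose c := (tree_rank t1 < tree_rank t0)%N.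
(* Equal ranks make the node's rank larger by one; unequal ranks make it the larger of the two. *)
have rank_c : (tree_rank (child c) < tree_rank (Node S t0 t1))%N.
  by rewrite /c /child /=; case: (ltngtP (tree_rank t0) (tree_rank t1)).
(* Whichever value [b] the coordinate [block p] has, the parity query can still be answered [c], so
   both branches continue in the same child. *)
have branch b : exists2 T : tree 'I_n, (tree_depth T <= tree_rank (child c))%N &
    forall z : cube n, (forall i, i \in U -> z i = z0 i) -> z (block p) = b ->
      tree_eval (bit_query z) T = f z.
  pose z1 : cube n := [ffun i => if i == block p then b else z0 i].
  have [||T Tr Tf] := IH c (block p |: U) z1 (phi \o force h p b c).
  - split=> [y v w|y v yv|y i] /=.
    + by rewrite force_affine // phiA.
    + by apply: (phiU); apply: force_eq yv => u w uw; rewrite /h (phiU u w).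
    + rewrite phiz in_setU1 [z1 i]ffunE.
      case: eqP => [->|/eqP ip] /=; last by rewrite force_other.
      by rewrite (negPf pU) force_block.
  - move=> y; rewrite /= -phit /= -/(h _) force_query //.
    by rewrite /child; case: (c).
  exists T => // z zU zp; apply: Tf => i; rewrite !inE ffunE.
  by case: eqP => [->|_ /zU].
have [[T0 T0r T0f] [T1 T1r T1f]] := (branch false, branch true).
exists (Node (block p) T0 T1) => [|z zU] /=.
  by rewrite (leq_ltn_trans _ rank_c) // geq_max T0r.
by rewrite /bit_query; case E: (z _); [apply: T1f | apply: T0f].
Qed.

Lemma D_le_parity_rank n (f : boolfun n) (t : tree {set 'I_(width n)}) :
  computes (@parity_query _) t (fun x => f (majs x)) -> (D f <= tree_rank t)%N.
Proof.
move=> tf.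
have [||T Tr Tf] := @restriction_simulation n f t finset.set0 [ffun=> false] id.
- split=> // [x y xy|x i]; last by rewrite inE.
  by apply/ffunP => q; apply: xy; rewrite inE.
- exact: tf.
rewrite /D /min_cost; case: ex_minnP => d _ dmin; apply: leq_trans Tr.
by apply: dmin; apply/asboolP; exists T => // z; apply: Tf => i; rewrite inE.
Qed.

Fixpoint parity_tree n (t : tree 'I_n) : tree {set 'I_n} :=
  match t with
  | Leaf b => Leaf b
  | Node i t0 t1 => Node [set i] (parity_tree t0) (parity_tree t1)
  end.

Lemma parity_tree_eval n (t : tree 'I_n) (x : cube n) :
  tree_eval (parity_query x) (parity_tree t) = tree_eval (bit_query x) t.
Proof. by elim: t => //= i t0 -> t1 ->; rewrite /parity_query big_set1. Qed.

Lemma parity_tree_rank n (t : tree 'I_n) :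
  tree_rank (parity_tree t) = tree_rank t.
Proof. by elim: t => //= i t0 -> t1 ->. Qed.

Lemma tree_rank_le_depth Q (t : tree Q) : (tree_rank t <= tree_depth t)%N.
Proof.
elim: t => //= _ t0 h0 t1 h1; case: eqP => [_|_].
  by rewrite ltnS (leq_trans h0) // leq_maxl.
by rewrite (leq_trans _ (leqnSn _)) // geq_max !leq_max h0 h1 orbT.
Qed.

(** A decision tree is a parity tree with singleton queries and the same rank, and rank is at most
    depth; so one bound serves both measures. *)
Lemma D_le_lifted (M : forall n : nat, boolfun n -> nat) n (f : boolfun n) :
  M = rank \/ M = PDT -> (D f <= M _ (fun x => f (@majs n x)))%N.
Proof.
case=> ->; rewrite /rank /PDT /min_cost; case: ex_minnP => _ /asboolP [t tf <-] _.
  rewrite -parity_tree_rank; apply: D_le_parity_rank => x.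
  by rewrite parity_tree_eval.
exact: leq_trans (D_le_parity_rank tf) (tree_rank_le_depth t).
Qed.

(** * Degree of the composed function *)

Section Degree.
Variable R : realType.

(** [mmeasure mdeg] exceeds the degree by one, hence [d.+1]. Any representing polynomial is allowed,
    which makes the notion closed under products. *)
Definition has_degree_le n (d : nat) (h : cube n -> R) : Prop :=
  exists2 p : mpoly n R, (mmeasure mdeg p <= d.+1)%N &
    forall x : cube n, meval (fun i => (x i)%:R) p = h x.

Lemma degree_le_ext n d (h k : cube n -> R) :
  h =1 k -> has_degree_le d h -> has_degree_le d k.
Proof. by move=> hk [p pd ph]; exists p => // x; rewrite ph. Qed.

Lemma degree_le_weaken n d d' (h : cube n -> R) :
  (d <= d')%N -> has_degree_le d h -> has_degree_le d' h.
Proof. by move=> dd' [p pd ph]; exists p => //; apply: leq_trans pd _. Qed.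

Lemma degree_le_add n d (h k : cube n -> R) :
  has_degree_le d h -> has_degree_le d k -> has_degree_le d (fun x => h x + k x).
Proof.
move=> [p pd ph] [q qd qk]; exists (p + q) => [|x]; last by rewrite mevalD ph qk.
by apply: leq_trans (mmeasureD_le _ _ _) _; rewrite geq_max pd.
Qed.

Lemma degree_le_mul n d e (h k : cube n -> R) :
  has_degree_le d h -> has_degree_le e k ->
  has_degree_le (d + e) (fun x => h x * k x).
Proof.
move=> [p pd ph] [q qe qk]; exists (p * q) => [|x]; last by rewrite mevalM ph qk.
have [->|p0] := eqVneq p 0; first by rewrite mul0r mmeasure0.
have [->|q0] := eqVneq q 0; first by rewrite mulr0 mmeasure0.
by rewrite msizeM // -subn1 leq_subLR (leq_trans (leq_add pd qe)) // addSn addnS.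
Qed.

Lemma degree_le_const n d (c : R) : has_degree_le d (fun=> c : R) (n := n).
Proof.
exists (mpolyC n c) => [|x]; last by rewrite mevalC.
by rewrite mmeasureC; case: (c != 0).
Qed.

Lemma degree_le_sum n (I : eqType) (r : seq I) d (h : I -> cube n -> R) :
  {in r, forall i, has_degree_le d (h i)} ->
  has_degree_le d (fun x => \sum_(i <- r) h i x).
Proof.
elim: r => [|i r IH] hr.
  by apply: degree_le_ext (degree_le_const _ _ 0) => x; rewrite big_nil.
have hi := hr i (mem_head _ _).
have {}IH := IH (fun j jr => hr j (mem_behead (s := i :: r) jr)).
by apply: degree_le_ext (degree_le_add hi IH) => x; rewrite big_cons.
Qed.

Lemma degree_le_prod n (I : Type) (r : seq I) (d : I -> nat)
    (h : I -> cube n -> R) :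
  (forall i, has_degree_le (d i) (h i)) ->
  has_degree_le (\sum_(i <- r) d i) (fun x => \prod_(i <- r) h i x).
Proof.
move=> hr; elim: r => [|i r IH].
  by apply: degree_le_ext (degree_le_const _ _ 1) => x; rewrite big_nil.
rewrite big_cons.
by apply: degree_le_ext (degree_le_mul (hr i) IH) => x; rewrite big_cons.
Qed.

Lemma degree_le_exp n d k (h : cube n -> R) :
  has_degree_le d h -> has_degree_le (d * k) (fun x => h x ^+ k).
Proof.
move=> hd; elim: k => [|k IH].
  by apply: degree_le_ext (degree_le_const _ _ 1).
rewrite mulnS.
by apply: degree_le_ext (degree_le_mul hd IH) => x; rewrite exprS.
Qed.

Lemma degree_le_bit n (i : 'I_n) : has_degree_le 1 (fun x => (x i)%:R).
Proof.
exists (mpolyX R (mnm1 i)) => [|x]; first by rewrite mmeasureX /= mdeg1.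
by rewrite mevalXU.
Qed.

(** On bits a, b, c the majority equals ab + ac + bc - 2abc. *)
Lemma degree_le_maj n (i : 'I_n) : has_degree_le 3 (fun x => (majs x i)%:R).
Proof.
have bit j := degree_le_bit (pos i j).
have prod2 j k := degree_le_mul (bit j) (bit k).
have w2 := @degree_le_weaken (width n) 2 3 _ isT.
have [p pd ph] := degree_le_add
  (degree_le_add (w2 _ (prod2 (Some false) (Some true)))
     (degree_le_add (w2 _ (prod2 (Some false) None))
        (w2 _ (prod2 (Some true) None))))
  (degree_le_mul (degree_le_mul (degree_le_const _ 0 (-2)) (bit None))
     (prod2 (Some false) (Some true))).
exists p => // x; rewrite ph ffunE /maj.
by case: (x _); case: (x _); case: (x _) => /=; ring.
Qed.

(** Capping all exponents at 1 changes no value on bits and raises no degree. The result is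
    multilinear, so by uniqueness it is the polynomial that defines [deg]. *)
Lemma deg_le n d (f : boolfun n) :
  has_degree_le d (fun x => (f x)%:R : R) -> (deg R f <= d)%N.
Proof.
move=> [p pd pf].
pose cut (m : multinom n) : multinom n := Multinom [tuple minn (m i) 1 | i < n].
have cutE m i : cut m i = minn (m i) 1 by rewrite /cut mnmE.
have cut_deg m : (mdeg (cut m) <= mdeg m)%N.
  by rewrite !mdegE; apply: leq_sum => i _; rewrite cutE geq_minl.
pose q : mpoly n R := \sum_(m <- msupp p) mcoeff m p *: mpolyX R (cut m).
have qM : multilinear q.
  apply/multilinearP => m mM; rewrite raddf_sum big1 //= => m' _.
  rewrite mcoeffZ mcoeffX; case: eqP => [mE|_]; last by rewrite mulr0.
  by case/negP: mM; apply/forallP => i; rewrite -mE cutE geq_minr.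
have qf : agrees q f.
  move=> x; rewrite -pf [RHS]mevalE raddf_sum; apply: eq_bigr => m _.
  rewrite /= mevalZ mevalX; congr (_ * _); apply: eq_bigr => i _.
  rewrite cutE; case: (x i); rewrite ?expr1n // !expr0n.
  by case: (m i).
have [rM rf] := projT2 (cid (multilinear_exists R f)).
rewrite /deg /multilinear_repr (multilinear_unique rM rf qM qf) -subn1 leq_subLR add1n.
apply: leq_trans (mmeasure_sum _ _ _ _) _; apply/bigmax_leqP_seq => m mp _.
  apply: leq_trans (mmeasureZ_le _ _ _) _; rewrite mmeasureX.
by rewrite (leq_trans _ pd) // (leq_ltn_trans (cut_deg m)) // mmeasure_mnm_lt.
Qed.

(** Substituting the cubic for majority into the polynomial of [f] at most triples the degree of
    each monomial. *)
Lemma deg_majs n (f : boolfun n) :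
  (deg R (fun x => f (@majs n x)) <= 3 * deg R f)%N.
Proof.
apply: deg_le; rewrite /deg /multilinear_repr.
case: (cid _) => p /= [pM pf].
suff : has_degree_le (3 * (mmeasure mdeg p).-1) (fun x : cube (width n) =>
    \sum_(m <- msupp p) mcoeff m p * \prod_i (majs x i)%:R ^+ m i).
  by apply: degree_le_ext => x; rewrite -pf mevalE.
apply: degree_le_sum => m /(mmeasure_mnm_lt mdeg) mp.
apply: (@degree_le_weaken _ (0 + \sum_i 3 * m i)).
  by rewrite add0n -big_distrr /= -mdegE leq_mul2l -ltnS (ltn_predK mp).
apply: degree_le_mul (degree_le_const _ _ _) _.
by apply: degree_le_prod => i; apply/degree_le_exp/degree_le_maj.
Qed.

End Degree.

(** * Block sensitivity of the composed function *)

Section BlockSensitivity.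
Variable R : realType.

Lemma fbs_at_le n (f : boolfun n) (x : cube n) : fbs_at R f x <= fbs R f.
Proof. exact: (le_bigmax _ (fun x => fbs_at R f x)). Qed.

Lemma fbs_ge0 n (f : boolfun n) : 0 <= fbs R f.
Proof. exact: bigmax_ge_id. Qed.

Lemma packing_le_fbs n (f : boolfun n) (x : cube n) (w : {set 'I_n} -> R) :
  fractional_packing f x w -> \sum_(B | sensitive f x B) w B <= fbs R f.
Proof.
move=> wP; apply: le_trans (fbs_at_le f x).
by apply: (sup_upper_bound (fbs_at_has_sup R f x)); exists w.
Qed.

Definition changed n (x : cube (width n)) (B : {set 'I_(width n)}) : {set 'I_n} :=
  [set i | majs x i (+) majs (flip x B) i].

Lemma flip_changed n (x : cube (width n)) B :
  flip (majs x) (changed x B) = majs (flip x B).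
Proof. by apply/ffunP => i; rewrite [LHS]ffunE inE addKb. Qed.

Lemma changed_bit n (x : cube (width n)) (B : {set 'I_(width n)}) i :
  i \in changed x B -> exists j, pos i j \in B.
Proof.
rewrite inE => iB; apply/existsP; apply: contraLR iB.
rewrite negb_exists => /forallP jB; rewrite !ffunE.
rewrite (_ : (fun j => flip x B (pos i j)) = fun j => x (pos i j)) ?addbb //.
by apply/funext => j; rewrite ffunE (negPf (jB j)) addbF.
Qed.

(** Each such set contains one of the three bits of block [i], and disjoint sets contain different
    ones. *)
Lemma card_changing_blocks n (x : cube (width n))
    (P : {set {set 'I_(width n)}}) i :
  finset.trivIset P -> (#|[set B in P | i \in changed x B]| <= 3)%N.
Proof.
move=> /finset.trivIsetP Ptriv.
(* The default [None] is never reached on sets that change majority [i]. *)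
pose g (B : {set 'I_(width n)}) := odflt None [pick j | pos i j \in B].
have gB B : i \in changed x B -> pos i (g B) \in B.
  move=> /changed_bit [j jB]; rewrite /g; case: pickP => //= none.
  by rewrite none in jB.
rewrite -(card_in_imset (f := g)).
  by rewrite (leq_trans (max_card _)) // card_option card_bool.
have memP B : B \in [set B in P | i \in changed x B] ->
    B \in P /\ i \in changed x B by rewrite finset.in_set => /andP.
move=> B C /memP[BP /gB iB] /memP[CP /gB iC] gBC.
apply/eqP; apply: contraT => /(Ptriv _ _ BP CP) /disjointFr /(_ iB).
by rewrite gBC iC.
Qed.

Lemma card_packing_le_fbs n (f : boolfun n) (x : cube (width n))
    (P : {set {set 'I_(width n)}}) :
  finset.trivIset P ->
  (forall B, B \in P -> sensitive (fun x => f (majs x)) x B) ->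
  #|P|%:R <= 3 * fbs R f.
Proof.
move=> Ptriv Psens.
have sens B : B \in P -> sensitive f (majs x) (changed x B).
  by move=> /Psens; rewrite /sensitive flip_changed.
(* Several members of [P] may project to the same [C]; their weights add up. *)
pose w (C : {set 'I_n}) : R := \sum_(B in P | changed x B == C) 3^-1.
have w0 C : 0 <= w C by apply: sumr_ge0 => *; rewrite invr_ge0.
have w_load i : \sum_(C | sensitive f (majs x) C && (i \in C)) w C <= 1.
  rewrite (_ : \sum_(C | _) _ =
    \sum_(B in [set B in P | i \in changed x B]) 3^-1); last first.
    rewrite [RHS](partition_big (changed x)
      (fun C => sensitive f (majs x) C && (i \in C))) /=.
      apply: eq_bigr => C /andP[_ iC]; apply: eq_bigl => B; rewrite inE.
      by case: eqP => [->|]; rewrite ?iC ?andbT ?andbF.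
    by move=> B; rewrite inE => /andP[/sens -> ->].
  rewrite sumr_const -[_^-1 *+ _]mulr_natl ler_pdivrMr // mul1r ler_nat.
  exact: card_changing_blocks.
have wP : fractional_packing f (majs x) w.
  split=> // C Csens; rewrite w0 /=.
  (* A sensitive [C] is nonempty, and [w C] is one term of the load at any of its elements, hence at
     most 1. *)
  have [C0|[i iC]] := set_0Vmem C.
    case/negP: Csens; rewrite C0; apply/eqP; congr f.
    by apply/ffunP => i; rewrite ffunE inE addbF.
  apply: le_trans (w_load i); rewrite (bigD1 C) ?Csens //= lerDl.
  exact: sumr_ge0.
have := packing_le_fbs wP.
rewrite (_ : \sum_(C | _) _ = \sum_(B in P) 3^-1); last first.
  by rewrite [RHS](partition_big (changed x) (sensitive f (majs x))).
by rewrite sumr_const -[_^-1 *+ _]mulr_natl ler_pdivrMr // mulrC.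
Qed.

Lemma bs_majs n (f : boolfun n) :
  (bs (fun x => f (@majs n x)))%:R <= 3 * fbs R f.
Proof.
have max_closed a b : a%:R <= 3 * fbs R f -> b%:R <= 3 * fbs R f ->
  (maxn a b)%:R <= 3 * fbs R f by rewrite /maxn; case: ifP.
rewrite /bs /bs_at.
apply: (big_ind (fun k => k%:R <= 3 * fbs R f)) => // [|x _].
  by rewrite mulr_ge0 ?fbs_ge0.
apply: (big_ind (fun k => k%:R <= 3 * fbs R f)) => //
  [|P /andP[Ptriv /forall_inP]].
  by rewrite mulr_ge0 ?fbs_ge0.
exact: card_packing_le_fbs.
Qed.

End BlockSensitivity.

(** * Transfer of the bounds *)

Lemma log2_ge0 (R : realType) n : (0 < n)%N -> 0 <= log2 R n.
Proof. by move=> n0; rewrite divr_ge0 ?ln_ge0 ?ler1n. Qed.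

(** For n at least 2, 3n is at most the cube of n. *)
Lemma log2_width (R : realType) n : (2 <= n)%N ->
  log2 R (width n) <= 3 * log2 R n.
Proof.
move=> n2; have n0 : (0 < n)%N by apply: ltnW.
rewrite /log2 mulrA ler_pM2r ?invr_gt0 ?ln_gt0 ?ltr1n //.
rewrite mulr_natl -lnXn ?ltr0n // -natrX ler_ln ?posrE ?ltr0n ?expn_gt0 ?n0 //.
  rewrite ler_nat widthE expnS leq_mul2l (leq_trans (_ : 3 <= 2 ^ 2)%N) ?orbT //.
  by rewrite leq_exp2r.
by rewrite widthE muln_gt0 n0.
Qed.

(** Common form of both claims: [a] is the measure in the hypothesis and [b] the one in the
    conclusion. The hypothesis is applied to [f] composed with [majs]. *)
Lemma lift_bound (R : realType) (M : forall n : nat, boolfun n -> nat)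
    (a b : forall n : nat, boolfun n -> R) :
  M = rank \/ M = PDT ->
  (forall n (f : boolfun n), 0 <= a n f) ->
  (forall n (f : boolfun n), a _ (fun x => f (@majs n x)) <= 3 * b n f) ->
  (exists c1 k1 : R, [/\ 0 < c1, 0 < k1 &
      forall (n : nat) (f : boolfun n), (2 <= n)%N ->
        (M n f)%:R <= c1 * a n f ^+ 2 * powR (log2 R n) k1]) ->
  exists c2 k2 : R, [/\ 0 < c2, 0 < k2 &
      forall (n : nat) (f : boolfun n), (2 <= n)%N ->
        (D f)%:R <= c2 * b n f ^+ 2 * powR (log2 R n) k2].
Proof.
move=> hM a0 ab [c [k [c0 k0 bound]]].
(* The 9 is the square of the factor in [a <= 3 * b]; [powR 3 k] absorbs the factor 3 from
   [log2_width]. *)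
exists (c * 9 * powR 3 k), k; split=> // [|n f n2].
  by rewrite !mulr_gt0 ?powR_gt0.
have n3 : (2 <= width n)%N by rewrite widthE (leq_trans n2) // leq_pmulr.
have DM : (D f)%:R <= (M _ (fun x => f (@majs n x)))%:R :> R.
  by rewrite ler_nat D_le_lifted.
apply: le_trans DM (le_trans (bound _ _ n3) _).
have -> : c * 9 * powR 3 k * b n f ^+ 2 * powR (log2 R n) k =
    c * (3 * b n f) ^+ 2 * powR (3 * log2 R n) k.
  by rewrite powRM ?log2_ge0 ?(ltnW n2) //; ring.
have l0 := log2_ge0 R (ltnW n3).
apply: ler_pM; rewrite ?powR_ge0 ?mulr_ge0 ?sqr_ge0 ?(ltW c0) //.
  by rewrite ler_pM2l // lerXn2r ?nnegrE ?a0 ?(le_trans (a0 _ _) (ab n f)).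
rewrite ge0_ler_powR ?nnegrE ?(ltW k0) ?log2_width //.
by rewrite mulr_ge0 // log2_ge0 // ltnW.
Qed.

Theorem theorem5 (R : realType) (M : forall n : nat, boolfun n -> nat)
    (hM : M = rank \/ M = PDT) :
  ((exists c1 k1 : R, [/\ 0 < c1, 0 < k1 &
      forall (n : nat) (f : boolfun n), (2 <= n)%N ->
        (M n f)%:R <= c1 * (deg R f)%:R ^+ 2 * powR (log2 R n) k1]) ->
   exists c2 k2 : R, [/\ 0 < c2, 0 < k2 &
      forall (n : nat) (f : boolfun n), (2 <= n)%N ->
        (D f)%:R <= c2 * (deg R f)%:R ^+ 2 * powR (log2 R n) k2])
  /\
  ((exists c1 k1 : R, [/\ 0 < c1, 0 < k1 &
      forall (n : nat) (f : boolfun n), (2 <= n)%N ->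
        (M n f)%:R <= c1 * (bs f)%:R ^+ 2 * powR (log2 R n) k1]) ->
   exists c2 k2 : R, [/\ 0 < c2, 0 < k2 &
      forall (n : nat) (f : boolfun n), (2 <= n)%N ->
        (D f)%:R <= c2 * fbs R f ^+ 2 * powR (log2 R n) k2]).
Proof.
split.
  apply: (lift_bound hM (a := fun n f => (deg R f)%:R)) => // n f.
  by rewrite -natrM ler_nat deg_majs.
apply: (lift_bound hM (a := fun n f => (bs f)%:R)) => // n f.
exact: bs_majs.
Qed.
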